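(* For any embedding $f:\mathcal{X}\to\mathbb{R}^d$ with values in the unit sphere, whenever $N\ge K-1$, $$L_{\mathrm{Sup}}(f)\;\le\;L^\mu_{\mathrm{Sup}}(f)\;\le\;\widetilde L^N_{\mathrm{Debiased}}(f).$$
   Context: Setting. $p$ is a probability distribution on a space $\mathcal{X}$; $\mathcal{C}$ is a finite set of latent classes with $|\mathcal{C}|\ge2$; $h:\mathcal{X}\to\mathcal{C}$ assigns to each point its class. The class distribution is uniform: for $x\sim p$, $\Pr(h(x)=c)=\rho(c)=\tau^+$ for every $c\in\mathcal{C}$, and $\tau^-=1-\tau^+$. For $c\in\mathcal{C}$, $p(\cdot|c)$ is $p$ conditioned on $h=c$. For $x\in\mathcal{X}$, $p_x^+$ denotes $p$ conditioned on $\{x':h(x')=h(x)\}$. Embeddings are measurable maps into the unit sphere of $\mathbb{R}^d$ (temperature $t=1$). Asymptotic debiased loss: $$\widetilde L^{N}_{\mathrm{Debiased}}(f)=\mathbb{E}_{x\sim p,\,x^+\sim p_x^+}\left[-\log\frac{e^{f(x)^Tf(x^+)}}{e^{f(x)^Tf(x^+)}+\frac{N}{\tau^-}\left(\mathbb{E}_{x^-\sim p}[e^{f(x)^Tf(x^-)}]-\tau^+\mathbb{E}_{v\sim p_x^+}[e^{f(x)^Tf(v)}]\right)}\right].$$ Supervised losses. A $K$-way task $\mathcal{T}$ is a set of $K$ distinct classes $\{c_1,\dots,c_K\}\subseteq\mathcal{C}$; $\mathcal{D}$ is the uniform distribution over all $K$-way tasks. For $W\in\mathbb{R}^{K\times d}$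 with rows $W_c$, $c\in\mathcal{T}$, $$L_{\mathrm{Softmax}}(\mathcal{T},Wf)=\mathbb{E}_{c\sim\mathrm{Unif}(\mathcal{T}),\,x\sim p(\cdot|c)}\left[-\log\frac{e^{W_cf(x)}}{\sum_{c'\in\mathcal{T}}e^{W_{c'}f(x)}}\right].$$ Set $L_{\mathrm{Sup}}(\mathcal{T},f)=\inf_{W\in\mathbb{R}^{K\times d}}L_{\mathrm{Softmax}}(\mathcal{T},Wf)$, and let $L^\mu_{\mathrm{Sup}}(\mathcal{T},f)=L_{\mathrm{Softmax}}(\mathcal{T},W^\mu f)$ be the loss of the mean classifier, where the row of $W^\mu$ for class $c$ is $\mu_c^T$ with $\mu_c=\mathbb{E}_{x\sim p(\cdot|c)}[f(x)]$. Finally $L_{\mathrm{Sup}}(f)=\mathbb{E}_{\mathcal{T}\sim\mathcal{D}}L_{\mathrm{Sup}}(\mathcal{T},f)$ and $L^\mu_{\mathrm{Sup}}(f)=\mathbb{E}_{\mathcal{T}\sim\mathcal{D}}L^\mu_{\mathrm{Sup}}(\mathcal{T},f)$. *)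

(* Defs.v *)
From HB Require Import structures.
From mathcomp Require Import all_boot all_order all_algebra.
From mathcomp Require Import all_classical all_reals all_analysis.

Set Implicit Arguments.
Unset Strict Implicit.
Unset Printing Implicit Defensive.
Import Order.TTheory GRing.Theory Num.Theory.

Local Open Scope classical_set_scope.
Local Open Scope ring_scope.

(* Real-valued expectations are written with the library's Rintegral,
   [\int[P]_x g x]; every integrand below is bounded for a measurable embedding
   with values in the unit sphere and a partition into classes of equal mass
   [tau] with [0 < tau < 1]. *)

Section Euclidean.
Context {R : realType} {n : nat}.

Definition dotp (u v : 'cV[R]_n) : R := (u^T *m v) 0 0.

(* The library's norm [`|u|] on matrices is the sup norm, hence this one. *)
Definition l2norm (u : 'cV[R]_n) : R := Num.sqrt (dotp u u).

(* The coordinatewise form of Borel measurability in R^n. *)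
Definition measurable_embedding {disp : measure_display}
    {X : measurableType disp} (f : X -> 'cV[R]_n) : Prop :=
  forall i : 'I_n, measurable_fun [set: X] (fun x => f x i 0).

End Euclidean.

Definition unif_mean {R : realType} {I : finType} (A : {pred I}) (g : I -> R) : R :=
  (\sum_(i in A) g i) / #|A|%:R.

(* [p] conditioned on [A]; when [p A = 0] it is the junk value [p]. *)
Definition cond_prob {disp : measure_display} {X : measurableType disp}
    {R : realType} (p : probability X R) (A : set X) (mA : measurable A) :
    probability X R :=
  mnormalize (mrestr p mA) p.

Section Losses.
Context {disp : measure_display} {X : measurableType disp} {R : realType}.
Context (p : probability X R) {C : finType} {h : X -> C}.
Hypothesis mh : forall c : C, measurable (h @^-1` [set c]).

Definition class_dist (c : C) : probability X R := cond_prob p (mh c).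

Definition pos_dist (x : X) : probability X R := class_dist (h x).

Definition debiased_loss (n N : nat) (tau : R) (f : X -> 'cV[R]_n) : R :=
  \int[p]_x \int[pos_dist x]_y
    - ln (expR (dotp (f x) (f y)) /
          (expR (dotp (f x) (f y)) +
           N%:R / (1 - tau) *
             ((\int[p]_z expR (dotp (f x) (f z))) -
              tau * (\int[pos_dist x]_v expR (dotp (f x) (f v)))))).

(* A task [T] is a set of classes; its classes are enumerated as [enum_val i],
   [i : 'I_#|T|], so a classifier is a #|T| x n matrix [W] whose row for the
   class [enum_val i] is [row i W]. *)

Definition softmax_loss (T : {set C}) (g : X -> 'cV[R]_#|T|) : R :=
  unif_mean predT (fun i : 'I_#|T| =>
    \int[class_dist (enum_val i)]_x
      - ln (expR (g x i 0) / \sum_(j < #|T|) expR (g x j 0))).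

Definition mean_classifier (n : nat) (T : {set C}) (f : X -> 'cV[R]_n) :
    'M[R]_(#|T|, n) :=
  \matrix_(i < #|T|, j < n) \int[class_dist (enum_val i)]_x f x j 0.

Definition sup_loss_task (n : nat) (T : {set C}) (f : X -> 'cV[R]_n) : R :=
  inf [set softmax_loss (fun x => W *m f x) | W in [set: 'M[R]_(#|T|, n)]].

Definition mean_sup_loss_task (n : nat) (T : {set C}) (f : X -> 'cV[R]_n) : R :=
  softmax_loss (fun x => mean_classifier T f *m f x).

Definition is_task (K : nat) : pred {set C} := fun T => #|T| == K.

Definition sup_loss (n K : nat) (f : X -> 'cV[R]_n) : R :=
  unif_mean (is_task K) (fun T => sup_loss_task T f).

Definition mean_sup_loss (n K : nat) (f : X -> 'cV[R]_n) : R :=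
  unif_mean (is_task K) (fun T => mean_sup_loss_task T f).

End Losses.

(* Main.v *)
Require Import Defs.
From HB Require Import structures.
From mathcomp Require Import all_boot all_order all_algebra.
From mathcomp Require Import all_classical all_reals all_analysis.
From mathcomp Require Import measurable_realfun ring.

Set Implicit Arguments.
Unset Strict Implicit.
Unset Printing Implicit Defensive.
Import Order.TTheory GRing.Theory Num.Theory.

Local Open Scope classical_set_scope.
Local Open Scope ring_scope.

(** For a task [T] containing [c], the mean classifier has loss [E_c F] with
    [F = ln (1 + \sum_(d in T, d != c) exp (f(x).(mu_d - mu_c)))]. Averaging
    over the K-tasks containing [c], each [d != c] occurs with frequency
    [(K - 1) / (m - 1)], [m] being the number of classes, so concavity of [ln]
    bounds the average by
    [ln (1 + N / (m - 1) \sum_(d != c) exp (f(x).(mu_d - mu_c)))].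
    In the debiased loss the subtraction removes the positive class, leaving
    [N / (m - 1) \sum_(d != c) E_d [exp (f(x).f(v))]] in the denominator. Jensen
    for [exp] turns each [E_d] into [exp (f(x).mu_d)], and Jensen for the convex
    function [t |-> ln (1 + a exp (- t))] turns the positive sample into [mu_c]. *)

(** * Tangent-line inequalities for [expR], [ln] and the softplus function *)

Section RealInequalities.
Context {R : realType}.
Implicit Types (a s t : R).

Lemma expR_tangent s t : expR s * (1 + (t - s)) <= expR t.
Proof.
have -> : expR t = expR s * expR (t - s) by rewrite -expRD; congr expR; ring.
by rewrite ler_wpM2l ?expR_ge0 ?expR_ge1Dx.
Qed.

Lemma ln_tangent s t : 0 < s -> 0 < t -> ln t <= ln s + (t - s) / s.
Proof.
move=> s0 t0.
have -> : (t - s) / s = t / s - 1 by rewrite mulrBl divff// gt_eqF.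
rewrite -lerBlDl -ln_div ?posrE//.
have := @le_ln1Dx R (t / s - 1); rewrite [1 + _]addrC subrK; apply.
by rewrite ltrBrDl subrr divr_gt0.
Qed.

(** Convexity of t |-> ln (1 + a exp (- t)), whose slope at [s] is - q with q = b / (1 + b). With r
    = s - t, exponentiating leaves (1 + b) exp (q r) <= 1 + b exp r, which is convexity of exp
    between 0 and r with weights 1 - q and q. *)
Lemma softplus_tangent a s t : 0 <= a ->
  ln (1 + a * expR (- s)) + - (a * expR (- s) / (1 + a * expR (- s))) * (t - s)
  <= ln (1 + a * expR (- t)).
Proof.
move=> a0; set b := a * expR (- s).
have b0 : 0 <= b by rewrite mulr_ge0 ?expR_ge0.
have b1 : 0 < 1 + b by rewrite ltr_pwDl.
have -> : a * expR (- t) = b * expR (s - t).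
  by rewrite /b -mulrA -expRD; congr (_ * expR _); ring.
set q := b / (1 + b); set r := s - t.
have r1 : 0 < 1 + b * expR r by rewrite ltr_pwDl// mulr_ge0 ?expR_ge0.
have -> : - q * (t - s) = q * r by rewrite /r; ring.
rewrite -lerBrDl -ln_div ?posrE// -ler_expR lnK ?posrE ?divr_gt0//.
have qE : (1 + b) * (1 - q) = 1.
  by rewrite /q; field; rewrite gt_eqF.
have bE : b = (1 + b) * q by rewrite /q mulrC divfK ?gt_eqF.
rewrite ler_pdivlMr// mulrC.
have := expR_tangent (q * r) 0; have := expR_tangent (q * r) r.
(* Both values of exp are compared with its tangent at q r. Adding the two bounds with weights 1 (at
   0) and b (at r) cancels the linear terms, because b = (1 + b) q. *)
rewrite expR0; move: (expR (q * r)) (expR r) => u v h1 h2.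
have := ler_wpM2l b0 h1.
rewrite [X in X * (u * _) <= _ -> _]bE => h3.
have -> : (1 + b) * u = u * (1 + (0 - q * r)) + (1 + b) * q * (u * (1 + (r - q * r))).
  have -> : u * (1 + (0 - q * r)) = (1 + b) * (1 - q) * u * (1 - q * r) by rewrite qE; ring.
  ring.
exact: lerD.
Qed.

End RealInequalities.

(** * Counting the tasks that contain given classes *)

Section Counting.
Context {C : finType}.

(** Complementation turns supersets of [D] into subsets of [~: D]. Choosing [#|C| - K] elements to
    leave out keeps the formula valid when [#|D| > K], where both sides vanish. *)
Lemma card_supersets (D : {set C}) (K : nat) : (K <= #|C|)%N ->
  #|[set T : {set C} | D \subset T & #|T| == K]| = 'C(#|~: D|, #|C| - K).
Proof.
move=> KC; rewrite -cards_draws -(card_imset _ (@finset.setC_inj C)).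
apply: eq_card => /= S; apply/imsetP/idP => /=.
  move=> [T]; rewrite !inE => /andP[DT /eqP TK ->].
  by rewrite finset.setCS DT cardsCs finset.setCK TK eqxx.
rewrite inE => /andP[SD /eqP SK]; exists (~: S); last by rewrite finset.setCK.
by rewrite inE -finset.setCS finset.setCK SD cardsCs finset.setCK SK subKn ?eqxx.
Qed.

End Counting.

(** * Expectations of bounded measurable functions *)

Section BoundedMeasurable.
Context {disp : measure_display} {X : measurableType disp} {R : realType}.
Implicit Types (g : X -> R) (Q : probability X R).

(** A class closed under the operations that build the integrands, and integrable under every
    probability, so that one proof serves [p] and all class conditionals. *)
Definition bounded_measurable g : Prop :=
  measurable_fun [set: X] g /\ exists M : R, forall x, `|g x| <= M.

Lemma bm_cst (k : R) : bounded_measurable (fun=> k).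
Proof. by split; [exact: measurable_cst | exists `|k|]. Qed.

Lemma bmD g1 g2 : bounded_measurable g1 -> bounded_measurable g2 ->
  bounded_measurable (fun x => g1 x + g2 x).
Proof.
move=> [m1 [M1 b1]] [m2 [M2 b2]]; split; first exact: measurable_funD.
by exists (M1 + M2) => x; rewrite (le_trans (ler_normD _ _))// lerD.
Qed.

Lemma bmM g1 g2 : bounded_measurable g1 -> bounded_measurable g2 ->
  bounded_measurable (fun x => g1 x * g2 x).
Proof.
move=> [m1 [M1 b1]] [m2 [M2 b2]]; split.
  exact: measurable_funM.
by exists (M1 * M2) => x; rewrite normrM ler_pM.
Qed.

Lemma bmN g : bounded_measurable g -> bounded_measurable (fun x => - g x).
Proof.
move=> [mg [M b]]; split; first exact: measurableT_comp.
by exists M => x; rewrite normrN.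
Qed.

Lemma bmB g1 g2 : bounded_measurable g1 -> bounded_measurable g2 ->
  bounded_measurable (fun x => g1 x - g2 x).
Proof. by move=> b1 b2; apply: bmD => //; exact: bmN. Qed.

Lemma bm_sum (I : Type) (s : seq I) (P : pred I) (G : I -> X -> R) :
  (forall i, P i -> bounded_measurable (G i)) ->
  bounded_measurable (fun x => \sum_(i <- s | P i) G i x).
Proof.
move=> bG; elim: s => [|i s IH].
  rewrite (_ : (fun x => _) = (fun=> 0)); first exact: bm_cst.
  by apply/funext => x; rewrite big_nil.
rewrite (_ : (fun x => _) = (fun x => if P i then G i x + \sum_(j <- s | P j) G j x
  else \sum_(j <- s | P j) G j x)); last by apply/funext => x; rewrite big_cons.
by case Pi: (P i) => //; apply: bmD => //; exact: bG.
Qed.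

Lemma bm_expR g : bounded_measurable g -> bounded_measurable (expR \o g).
Proof.
move=> [mg [M b]]; split; first exact: measurableT_comp.
exists (expR M) => x /=.
by rewrite ger0_norm ?expR_ge0// ler_expR (le_trans (ler_norm _)).
Qed.

Lemma bm_ln1D g : (forall x, 0 <= g x) -> bounded_measurable g ->
  bounded_measurable (fun x => ln (1 + g x)).
Proof.
move=> g0 [mg [M b]]; split.
  by apply: measurableT_comp => //; exact: measurable_funD.
exists M => x; rewrite ger0_norm ?ln_ge0 ?lerDl//.
apply: le_trans (b x); rewrite ger0_norm// le_ln1Dx//.
exact: lt_le_trans (g0 x).
Qed.

Lemma bm_indic (A : set X) : measurable A -> bounded_measurable (\1_A : X -> R).
Proof.
move=> mA; split; first exact: measurable_indic.
by exists 1 => x; rewrite indicE; case: (_ \in _); rewrite ?normr1 ?normr0.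
Qed.

Lemma bm_integrable Q g : bounded_measurable g -> Q.-integrable setT (EFin \o g).
Proof.
move=> [mg [M b]]; apply: measurable_bounded_integrable => //.
  by rewrite (@le_lt_trans _ _ 1%E) ?probability_le1 ?ltry.
exists M; split; first exact: num_real.
by move=> N MN x _; exact: le_trans (b x) (ltW MN).
Qed.

Lemma bm_le_Rintegral Q g1 g2 :
  bounded_measurable g1 -> bounded_measurable g2 ->
  (forall x, g1 x <= g2 x) -> \int[Q]_x g1 x <= \int[Q]_x g2 x.
Proof. by move=> b1 b2 le12; apply: le_Rintegral => //; exact: bm_integrable. Qed.

Lemma prob_Rintegral_cst Q (k : R) : \int[Q]_x k = k.
Proof. by rewrite Rintegral_cst//= probability_setT mulr1. Qed.

Lemma bm_RintegralD Q g1 g2 :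
  bounded_measurable g1 -> bounded_measurable g2 ->
  \int[Q]_x (g1 x + g2 x) = \int[Q]_x g1 x + \int[Q]_x g2 x.
Proof. by move=> b1 b2; apply: RintegralD => //; exact: bm_integrable. Qed.

Lemma bm_RintegralZl Q (k : R) g : bounded_measurable g ->
  \int[Q]_x (k * g x) = k * \int[Q]_x g x.
Proof. by move=> b; apply: RintegralZl => //; exact: bm_integrable. Qed.

Lemma bm_Rintegral_sum Q (I : Type) (s : seq I) (P : pred I) (G : I -> X -> R) :
  (forall i, bounded_measurable (G i)) ->
  \int[Q]_x (\sum_(i <- s | P i) G i x) = \sum_(i <- s | P i) \int[Q]_x G i x.
Proof.
move=> bG; elim: s => [|i s IH].
  by rewrite big_nil; under eq_Rintegral do rewrite big_nil; exact: prob_Rintegral_cst.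
rewrite big_cons; under eq_Rintegral do rewrite big_cons.
case: ifPn => // Pi.
by rewrite bm_RintegralD ?IH//; exact: bm_sum.
Qed.

Lemma bm_EFin_Rintegral Q g : bounded_measurable g ->
  (\int[Q]_x g x)%:E = (\int[Q]_x (g x)%:E)%E.
Proof.
by move=> bg; rewrite fineK// integrable_fin_num//; exact: bm_integrable.
Qed.

(** Jensen from a supporting line: the affine minorant of [phi] is centred at the mean of [g], so
    its linear part integrates to zero and only [a] remains. *)
Lemma Jensen_tangent Q g phi (a k : R) :
  bounded_measurable g -> bounded_measurable phi ->
  (forall x, a + k * (g x - \int[Q]_y g y) <= phi x) ->
  a <= \int[Q]_x phi x.
Proof.
move=> bg bphi le_phi.
have bl : bounded_measurable (fun x => k * (g x - \int[Q]_y g y)).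
  by apply: bmM; [exact: bm_cst | apply: bmB => //; exact: bm_cst].
suff {1}-> : a = \int[Q]_x (a + k * (g x - \int[Q]_y g y)).
  by apply: bm_le_Rintegral => //; apply: bmD => //; exact: bm_cst.
rewrite bm_RintegralD ?prob_Rintegral_cst//; last exact: bm_cst.
rewrite bm_RintegralZl; last by apply: bmB => //; exact: bm_cst.
rewrite bm_RintegralD//; last exact: bm_cst.
by rewrite prob_Rintegral_cst subrr mulr0 addr0.
Qed.

(* The larger function need not be measurable: the integral of a nonnegative
   function is a supremum over the simple functions below it. *)
Lemma le_Rintegral_bounded Q g1 g2 (M : R) :
  (forall x, 0 <= g1 x) -> (forall x, g1 x <= g2 x) -> (forall x, g2 x <= M) ->
  \int[Q]_x g1 x <= \int[Q]_x g2 x.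
Proof.
move=> g10 le12 g2M.
have mono (u v : X -> R) : (forall x, 0 <= u x) -> (forall x, u x <= v x) ->
    (\int[Q]_x (u x)%:E <= \int[Q]_x (v x)%:E)%E.
  move=> u0 uv; have v0 x : 0 <= v x by exact: le_trans (u0 x) (uv x).
  rewrite !ge0_integralTE//.
  apply: ereal_sup_le => _ [w wu <-]; exists w => //= x.
  by rewrite (le_trans (wu x)) ?lee_fin.
have fin (u : X -> R) : (forall x, 0 <= u x) -> (forall x, u x <= M) ->
    (\int[Q]_x (u x)%:E)%E \is a fin_num.
  move=> u0 uM; rewrite ge0_fin_numE; last first.
    by apply: integral_ge0 => x _; rewrite lee_fin.
  apply: le_lt_trans (mono _ _ u0 uM) _.
  by rewrite integral_cst// [X in (_ * X)%E]probability_setT mule1 ltry.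
have g20 x : 0 <= g2 x by exact: le_trans (g10 x) (le12 x).
by apply: fine_le; [apply: fin => // x; exact: le_trans (le12 x) _
                  | exact: fin | exact: mono].
Qed.

End BoundedMeasurable.

(** * Jensen's inequality for exp and softplus *)

Section JensenExp.
Context {disp : measure_display} {X : measurableType disp} {R : realType}.
Implicit Types (g : X -> R) (Q : probability X R).

Lemma Jensen_expR Q g : bounded_measurable g ->
  expR (\int[Q]_x g x) <= \int[Q]_x expR (g x).
Proof.
move=> bg; set s := Rintegral _ _ _.
apply: (@Jensen_tangent _ _ _ _ g _ _ (expR s)) => //; first exact: bm_expR.
by move=> x; have := expR_tangent s (g x); rewrite mulrDr mulr1.
Qed.

Lemma bm_softplus g (a : R) : 0 <= a -> bounded_measurable g ->
  bounded_measurable (fun x => ln (1 + a * expR (- g x))).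
Proof.
move=> a0 bg; apply: bm_ln1D => [x|]; first by rewrite mulr_ge0 ?expR_ge0.
by apply: bmM; [exact: bm_cst | apply/bm_expR/bmN].
Qed.

Lemma Jensen_softplus Q g (a : R) : 0 <= a -> bounded_measurable g ->
  ln (1 + a * expR (- \int[Q]_x g x)) <= \int[Q]_x ln (1 + a * expR (- g x)).
Proof.
move=> a0 bg.
apply: (@Jensen_tangent _ _ _ _ g) => //; first exact: bm_softplus.
by move=> x; exact: softplus_tangent.
Qed.

End JensenExp.

(** * Conditioning on a class and the law of total expectation *)

Section ClassConditionals.
Context {disp : measure_display} {X : measurableType disp} {R : realType}.
Context (p : probability X R) {C : finType} {h : X -> C}.
Context (mh : forall c : C, measurable (h @^-1` [set c])).
Context {tau : R} (unif_h : forall c : C, p (h @^-1` [set c]) = tau%:E).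

Local Notation indic_class c := (\1_(h @^-1` [set c]) : X -> R).

Lemma indic_classE c x : indic_class c x = (h x == c)%:R.
Proof.
rewrite indicE; congr (nat_of_bool _)%:R.
by apply/idP/idP => [|/eqP hx]; rewrite inE //= => ->.
Qed.

(** Measurability and integration of a function that depends on x through its class reduce to a
    finite sum over fixed classes. *)
Lemma by_classE (l : C -> X -> R) :
  (fun x => l (h x) x) = (fun x => \sum_c indic_class c x * l c x).
Proof.
apply/funext => x; rewrite (bigD1 (h x))//= indic_classE eqxx mul1r.
rewrite big1 ?addr0// => c cx.
by rewrite indic_classE eq_sym (negbTE cx) mul0r.
Qed.

Lemma bm_by_class (l : C -> X -> R) : (forall c, bounded_measurable (l c)) ->
  bounded_measurable (fun x => l (h x) x).
Proof.
move=> bl; rewrite by_classE; apply: bm_sum => c _.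
by apply: bmM => //; exact: bm_indic.
Qed.

(** The constant 1, integrated class by class, has total mass 1. *)
Lemma card_classes_tau : #|C|%:R * tau = 1.
Proof.
have := prob_Rintegral_cst p 1.
rewrite [X in Rintegral _ _ X](by_classE (fun _ _ => 1)) bm_Rintegral_sum; last first.
  by move=> c; apply: bmM; [exact: bm_indic | exact: bm_cst].
rewrite (eq_bigr (fun=> tau)); first by rewrite sumr_const mulr_natl.
move=> c _; under eq_Rintegral do rewrite mulr1.
rewrite -[RHS](congr1 fine (unif_h c)).
by congr fine; rewrite integral_indic// setIT.
Qed.

Lemma tau_gt0 : 0 < tau.
Proof.
have := card_classes_tau; have [//|tau_le0] := ltP 0 tau.
move=> E; have : (#|C|%:R * tau <= 0 :> R) by rewrite mulr_ge0_le0.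
by rewrite E ler10.
Qed.

Lemma tauE : tau = #|C|%:R^-1.
Proof.
have C0 : #|C|%:R != 0 :> R.
  by apply/eqP => C0; have := card_classes_tau; rewrite C0 mul0r => /esym/eqP; rewrite oner_eq0.
by apply: (mulfI C0); rewrite divff// card_classes_tau.
Qed.

Lemma class_distE c (A : set X) :
  class_dist p mh c A = (p (A `&` h @^-1` [set c]) * (tau^-1)%:E)%E.
Proof.
have pT : mrestr p (mh c) [set: X] = tau%:E.
  by rewrite -[RHS](unif_h c) -[in RHS](setTI (h @^-1` _)).
rewrite /class_dist /cond_prob /= /mnormalize /= pT.
(* Positivity of [tau] rules out the default value of [mnormalize] at null mass. *)
by rewrite eqe gt_eqF ?tau_gt0.
Qed.

(** The conditional law gives no mass to the complement of the class, and on subsets of the class it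
    is [p] scaled by [tau^-1]. *)
Lemma class_dist_integral c (g : X -> R) : (forall x, 0 <= g x) ->
  bounded_measurable g ->
  tau * \int[class_dist p mh c]_x g x = \int[p]_x (indic_class c x * g x).
Proof.
move=> g0 bg; set D := h @^-1` [set c].
have mg : measurable_fun setT (EFin \o g) by apply/measurable_EFinP; case: bg.
have bIg : bounded_measurable (fun x => indic_class c x * g x).
  by apply: bmM => //; exact: bm_indic.
apply: EFin_inj; rewrite EFinM !bm_EFin_Rintegral//.
have ti0 : 0 <= tau^-1 by rewrite invr_ge0 ltW ?tau_gt0.
rewrite (@ge0_negligible_integral _ _ _ _ _ (~` D))//; last 3 first.
- by apply: measurableC; exact: mh.
- by move=> x _; rewrite lee_fin.
- by apply: (etrans (class_distE _ _)); rewrite setICl measure0 mul0e.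
rewrite setTD setCK.
rewrite (@eq_measure_integral _ _ _ _ (mscale (NngNum ti0) p)); last first.
  by move=> A mA AD; apply: (etrans (class_distE _ _)); rewrite (setIidl AD) muleC.
rewrite ge0_integral_mscale; last 3 first.
- exact: mh.
- exact: measurable_funTS.
- by move=> x _; rewrite lee_fin.
rewrite muleA -EFinM divff ?gt_eqF ?tau_gt0// mul1e integral_mkcond.
by apply: eq_integral => x _; rewrite epatch_indic /= -EFinM mulrC.
Qed.

Lemma integral_by_class (l : C -> X -> R) : (forall c x, 0 <= l c x) ->
  (forall c, bounded_measurable (l c)) ->
  \int[p]_x l (h x) x = tau * \sum_c \int[class_dist p mh c]_x l c x.
Proof.
move=> l0 bl; rewrite by_classE bm_Rintegral_sum; last first.
  by move=> c; apply: bmM => //; exact: bm_indic.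
by rewrite mulr_sumr; apply: eq_bigr => c _; rewrite class_dist_integral.
Qed.

End ClassConditionals.

(** * Averaging the logarithm over the tasks containing a class *)

Section TaskAverage.
Context {R : realType} {C : finType}.

(** The tangent of [ln] is taken at the target 1 + r W instead of at the mean of the arguments. This
    merges concavity and monotonicity: it is enough that the tasks average the inner sums to at most
    r W. *)
Lemma sum_tasks_ln (K : nat) (c : C) (w : C -> R) (r : R) :
  (1 < #|C|)%N -> (0 < K <= #|C|)%N -> 0 <= r ->
  (K.-1)%:R <= r * (#|C|.-1)%:R -> (forall d, 0 <= w d) ->
  \sum_(T : {set C} | (#|T| == K) && (c \in T)) ln (1 + \sum_(d in T | d != c) w d)
  <= 'C(#|C|.-1, #|C| - K)%:R * ln (1 + r * \sum_(d | d != c) w d).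
Proof.
move=> C1 /andP[K0 KC] r0 rK w0.
set B := 'C(_, _); set W := \sum_(d | d != c) w d.
have cardB : #|[pred T : {set C} | (#|T| == K) && (c \in T)]| = B.
  transitivity (#|[set T : {set C} | [set c]%SET \subset T & #|T| == K]|).
    by apply: eq_card => T; rewrite !inE finset.sub1set andbC.
  by rewrite card_supersets// /B cardsC1.
pose B' := 'C(#|C|.-2, #|C| - K).
have cardB' d : d != c ->
    #|[pred T : {set C} | [&& #|T| == K, c \in T & d \in T]]| = B'.
  move=> dc; transitivity (#|[set T : {set C} | [set d; c]%SET \subset T & #|T| == K]|).
    apply: eq_card => T; rewrite !inE finset.subUset !finset.sub1set andbC.
    by rewrite [(_ \in T) && _]andbC.
  rewrite card_supersets// /B'; congr 'C(_, _).
  by rewrite -(cardsC [set d; c]%SET) cards2 dc.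
(* With m classes, (m - 1) B' = (K - 1) B: another class d lies in a fraction (K - 1) / (m - 1) of
   the tasks containing c, and the hypothesis on [r] bounds this fraction. *)
have B'r : B'%:R <= r * B%:R :> R.
  have C0 : 0 < (#|C|.-1)%:R :> R by rewrite ltr0n -ltnS prednK// (ltn_trans _ C1).
  rewrite -(ler_pM2l C0) -natrM mul_bin_down.
  have -> : (#|C|.-1 - (#|C| - K) = K.-1)%N.
    by rewrite -subn1 subnAC subKn// subn1.
  by rewrite natrM mulrA ler_wpM2r// mulrC.
have sumS : \sum_(T : {set C} | (#|T| == K) && (c \in T)) \sum_(d in T | d != c) w d
    = B'%:R * W.
  rewrite (exchange_big_dep (fun d => d != c)) /=; last by move=> T d _ /andP[].
  rewrite mulr_sumr; apply: eq_bigr => d dc.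
  rewrite mulr_natl -(cardB' _ dc) -sumr_const; apply: eq_bigl => T.
  (* After the exchange of sums, each [w d] is counted once per task containing both c and d, that
     is [B'] times. *)
  by rewrite !inE dc andbT andbA.
have W0 : 0 <= W by apply: sumr_ge0.
set s0 := 1 + r * W; have s00 : 0 < s0 by rewrite ltr_pwDl// mulr_ge0.
have -> : B%:R * ln s0 = \sum_(T : {set C} | (#|T| == K) && (c \in T)) ln s0.
  by rewrite -cardB mulr_natl -sumr_const.
rewrite -subr_le0 -sumrB.
pose S (T : {set C}) := \sum_(d in T | d != c) w d.
apply: (@le_trans _ _ (\sum_(T : {set C} | (#|T| == K) && (c \in T)) (S T - r * W) / s0)).
  apply: ler_sum => T _.
  have S0 : 0 <= S T by apply: sumr_ge0.
  rewrite lerBlDl (le_trans (ln_tangent s00 (_ : 0 < 1 + S T)))//.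
    by rewrite ltr_pwDl.
  by rewrite lerD2l /s0 opprD addrACA subrr add0r.
rewrite -mulr_suml pmulr_lle0 ?invr_gt0// sumrB sumS.
rewrite [X in _ - X](_ : _ = B%:R * (r * W)); last first.
  by rewrite -cardB mulr_natl -sumr_const.
by rewrite mulrA -mulrBl mulr_le0_ge0// subr_le0 mulrC.
Qed.

End TaskAverage.

(** * Boundedness and means of embeddings into the sphere *)

Section Embedding.
Context {disp : measure_display} {X : measurableType disp} {R : realType}.
Context {n : nat} {f : X -> 'cV[R]_n}.
Hypotheses (mf : measurable_embedding f) (f_sphere : forall x, l2norm (f x) = 1).

Lemma dotpE (u v : 'cV[R]_n) : dotp u v = \sum_i u i 0 * v i 0.
Proof. by rewrite /dotp mxE; apply: eq_bigr => i _; rewrite mxE. Qed.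

Lemma coord_le1 x i : `|f x i 0| <= 1.
Proof.
have dot1 : dotp (f x) (f x) = 1.
  have := f_sphere x; rewrite /l2norm => /(congr1 (fun t => t ^+ 2)).
  rewrite sqr_sqrtr ?expr1n// dotpE sumr_ge0// => j _.
  by rewrite -expr2 sqr_ge0.
rewrite -(@ler_pXn2r _ 2)// ?nnegrE// expr1n real_normK ?num_real//.
rewrite -dot1 dotpE (bigD1 i)//= -expr2 lerDl sumr_ge0// => j _.
by rewrite -expr2 sqr_ge0.
Qed.

(** Each of the [n] products of coordinates is at most 1 in absolute value; this crude bound serves
    only to keep the integrands bounded. *)
Lemma dotp_le x y : `|dotp (f x) (f y)| <= n%:R.
Proof.
rewrite dotpE (le_trans (ler_norm_sum _ _ _))//.
rewrite -[leRHS](_ : \sum_(i < n) 1 = _); last by rewrite sumr_const card_ord.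
by apply: ler_sum => i _; rewrite normrM mulr_ile1 ?coord_le1.
Qed.

Lemma bm_coord i : bounded_measurable (fun x => f x i 0).
Proof. by split; [exact: mf | exists 1 => x; exact: coord_le1]. Qed.

Lemma bm_dotp u : bounded_measurable (fun x => dotp u (f x)).
Proof.
rewrite (_ : (fun x => _) = (fun x => \sum_i u i 0 * f x i 0)); last first.
  by apply/funext => x; rewrite dotpE.
by apply: bm_sum => i _; apply: bmM; [exact: bm_cst | exact: bm_coord].
Qed.

Lemma bm_dotpr u : bounded_measurable (fun x => dotp (f x) u).
Proof.
rewrite (_ : (fun x => _) = (fun x => dotp u (f x))); first exact: bm_dotp.
by apply/funext => x; rewrite !dotpE; apply: eq_bigr => i _; rewrite mulrC.
Qed.

Lemma Rintegral_dotp (Q : probability X R) u :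
  \int[Q]_y dotp u (f y) = dotp u (\col_i \int[Q]_y f y i 0).
Proof.
under eq_Rintegral do rewrite dotpE.
rewrite bm_Rintegral_sum; last first.
  by move=> i; apply: bmM; [exact: bm_cst | exact: bm_coord].
rewrite dotpE; apply: eq_bigr => i _; rewrite mxE.
by rewrite bm_RintegralZl//; exact: bm_coord.
Qed.

End Embedding.

(** * Cross-entropy in softplus form *)

Section Softmax.
Context {R : realType}.

Lemma softmaxE (t s : R) : 0 <= s ->
  - ln (expR t / (expR t + s)) = ln (1 + s * expR (- t)).
Proof.
move=> s0; have e0 := expR_gt0 t.
have ets0 : 0 < expR t + s by rewrite ltr_pwDl.
rewrite -lnV ?posrE ?divr_gt0// invf_div; congr ln.
by rewrite mulrDl divff ?gt_eqF// expRN.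
Qed.

Lemma softmax_taskE {C : finType} (T : {set C}) (v : C -> R) (i : 'I_#|T|) :
  - ln (expR (v (enum_val i)) / \sum_(j < #|T|) expR (v (enum_val j)))
  = ln (1 + \sum_(d in T | d != enum_val i) expR (v d - v (enum_val i))).
Proof.
rewrite -(big_enum_val (fun d => expR (v d))) (bigD1 (enum_val i)) ?enum_valP//=.
rewrite softmaxE; last by apply: sumr_ge0 => d _; exact: expR_ge0.
by congr (ln (1 + _)); rewrite mulr_suml; apply: eq_bigr => d _; rewrite -expRD.
Qed.

End Softmax.

(** * Comparison of the three losses *)

Section Losses.
Context {R : realType} {disp : measure_display} {X : measurableType disp}.
Context (p : probability X R) {C : finType} {h : X -> C}.
Context (mh : forall c : C, measurable (h @^-1` [set c])).

Lemma sup_loss_le_mean {n : nat} (K : nat) (f : X -> 'cV[R]_n) :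
  sup_loss p mh K f <= mean_sup_loss p mh K f.
Proof.
rewrite /sup_loss /mean_sup_loss /unif_mean ler_wpM2r ?invr_ge0//.
apply: ler_sum => T _; apply: ge_inf; last by exists (mean_classifier p mh T f).
(* A real [inf] lies below the members of its set only if the set has a lower bound. Here 0 is one,
   every softmax ratio being at most 1. *)
exists 0 => _ [W _ <-].
apply: divr_ge0 => //; apply: sumr_ge0 => i _; apply: Rintegral_ge0 => x _.
rewrite oppr_ge0 ln_le0// ler_pdivrMr.
  by rewrite mul1r (bigD1 i)//= lerDl sumr_ge0// => j _; exact: expR_ge0.
rewrite (bigD1 i)//= ltr_pwDl ?expR_gt0// sumr_ge0// => j _; exact: expR_ge0.
Qed.

Context {tau : R} (unif_h : forall c : C, p (h @^-1` [set c]) = tau%:E).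
Context {n : nat} {f : X -> 'cV[R]_n}.
Hypotheses (mf : measurable_embedding f) (f_sphere : forall x, l2norm (f x) = 1).

Definition class_mean (c : C) : 'cV[R]_n :=
  \col_i \int[class_dist p mh c]_x f x i 0.

Definition mean_gap (c d : C) (x : X) : R :=
  expR (dotp (f x) (class_mean d) - dotp (f x) (class_mean c)).

(** The intermediate integrand: its average over classes lies above the mean-classifier loss and
    below the debiased loss, for a suitable weight [r]. *)
Definition mean_bound (r : R) (c : C) (x : X) : R :=
  ln (1 + r * \sum_(d | d != c) mean_gap c d x).

Lemma mean_gap_ge0 c d x : 0 <= mean_gap c d x.
Proof. exact: expR_ge0. Qed.

Lemma bm_mean_gap c d : bounded_measurable (mean_gap c d).
Proof. by apply: bm_expR; apply: bmB; exact: bm_dotpr. Qed.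

Lemma bm_mean_bound r c : 0 <= r -> bounded_measurable (mean_bound r c).
Proof.
move=> r0; apply: bm_ln1D => [x|].
  by rewrite mulr_ge0// sumr_ge0// => d _; exact: mean_gap_ge0.
by apply: bmM; [exact: bm_cst | apply: bm_sum => d _; exact: bm_mean_gap].
Qed.

Lemma mean_bound_ge0 r c x : 0 <= r -> 0 <= mean_bound r c x.
Proof.
move=> r0; rewrite ln_ge0// lerDl mulr_ge0// sumr_ge0// => d _.
exact: mean_gap_ge0.
Qed.

Lemma mean_sup_loss_taskE (T : {set C}) :
  mean_sup_loss_task p mh T f =
  (\sum_(c in T) \int[class_dist p mh c]_x
     ln (1 + \sum_(d in T | d != c) mean_gap c d x)) / #|T|%:R.
Proof.
rewrite /mean_sup_loss_task /softmax_loss /unif_mean card_ord; congr (_ / _).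
rewrite [RHS]big_enum_val; apply: eq_bigr => i _; apply: eq_Rintegral => x _.
have gE j : (mean_classifier p mh T f *m f x) j 0
    = dotp (f x) (class_mean (enum_val j)).
  by rewrite dotpE mxE; apply: eq_bigr => k _; rewrite !mxE mulrC.
under eq_bigr do rewrite gE.
by rewrite gE (softmax_taskE (fun d => dotp (f x) (class_mean d))).
Qed.

Lemma mean_sup_loss_le (K : nat) (r : R) :
  (1 < #|C|)%N -> (0 < K <= #|C|)%N -> 0 <= r ->
  (K.-1)%:R <= r * (#|C|.-1)%:R ->
  mean_sup_loss p mh K f <=
  tau * \sum_c \int[class_dist p mh c]_x mean_bound r c x.
Proof.
move=> C1 KP r0 rK; have /andP[K0 KC] := KP.
pose F (T : {set C}) c x := ln (1 + \sum_(d in T | d != c) mean_gap c d x).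
have bmF T c : bounded_measurable (F T c).
  apply: bm_ln1D => [x|]; first by apply: sumr_ge0 => d _; exact: mean_gap_ge0.
  by apply: bm_sum => d _; exact: bm_mean_gap.
have cardK : #|is_task K : pred {set C}| = 'C(#|C|, K).
  by rewrite -card_draws; apply: eq_card => T; rewrite inE.
rewrite /mean_sup_loss /unif_mean cardK.
have -> : \sum_(T in is_task K) mean_sup_loss_task p mh T f =
    (\sum_c \sum_(T : {set C} | (#|T| == K) && (c \in T))
       \int[class_dist p mh c]_x F T c x) / K%:R.
  rewrite -(exchange_big_dep (P := fun T : {set C} => #|T| == K)
    (Q := fun T c => c \in T) xpredT)//= mulr_suml.
  by apply: eq_bigr => T /eqP TK; rewrite mean_sup_loss_taskE TK.
have D0 : 0 < K%:R * 'C(#|C|, K)%:R :> R.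
  by rewrite mulr_gt0 ?ltr0n ?bin_gt0.
rewrite -mulrA -invfM ler_pdivrMr//.
(* With m classes, K 'C(m, K) = m 'C(m - 1, m - K) counts the pairs of a task and one of its
   classes, and the factor m cancels against [tau]. *)
have -> : tau * (\sum_c \int[class_dist p mh c]_x mean_bound r c x)
      * (K%:R * 'C(#|C|, K)%:R)
    = \sum_c 'C(#|C|.-1, #|C| - K)%:R * \int[class_dist p mh c]_x mean_bound r c x.
  rewrite -mulr_sumr mulrAC; congr (_ * _).
  rewrite -natrM -bin_sub// -{1}(subKn KC) -mul_bin_down natrM mulrA.
  by rewrite [tau * _]mulrC (card_classes_tau mh unif_h) mul1r.
apply: ler_sum => c _.
(* The law of x given c does not depend on the task, so the sum over tasks moves inside the integral
   and is bounded pointwise in x. *)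
rewrite -bm_Rintegral_sum// -bm_RintegralZl; last exact: bm_mean_bound.
apply: bm_le_Rintegral => [||x].
- by apply: bm_sum.
- by apply: bmM; [exact: bm_cst | exact: bm_mean_bound].
- by apply: sum_tasks_ln => // d; exact: mean_gap_ge0.
Qed.

Lemma debiased_loss_ge (N : nat) : (1 < #|C|)%N ->
  tau * \sum_c \int[class_dist p mh c]_x
    mean_bound (N%:R / (1 - tau) * tau) c x
  <= debiased_loss p mh N tau f.
Proof.
move=> C1; set r := _ * tau.
have tau0 := tau_gt0 mh unif_h.
have tau1 : 0 < 1 - tau.
  by rewrite subr_gt0 (tauE mh unif_h) invf_lt1 ?ltr1n// ltr0n (ltn_trans _ C1).
have k0 : 0 <= N%:R / (1 - tau) by rewrite divr_ge0// ltW.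
have r0 : 0 <= r by rewrite mulr_ge0// ltW.
have bme u : bounded_measurable (fun y => expR (dotp u (f y))).
  by apply: bm_expR; exact: bm_dotp.
pose S x := \sum_(d | d != h x) \int[class_dist p mh d]_y expR (dotp (f x) (f y)).
have S0 x : 0 <= S x.
  by apply: sumr_ge0 => d _; apply: Rintegral_ge0 => y _; exact: expR_ge0.
(* By total expectation the subtraction cancels exactly the term of the class of x. What remains is
   nonnegative, as [softmaxE] requires. *)
have SE x : (\int[p]_z expR (dotp (f x) (f z))) -
    tau * (\int[pos_dist p mh x]_v expR (dotp (f x) (f v))) = tau * S x.
  rewrite (integral_by_class mh unif_h (l := fun _ y => expR (dotp (f x) (f y))))//.
  by rewrite (bigD1 (h x))//= mulrDr addrAC subrr add0r.
have lossE : debiased_loss p mh N tau f = \int[p]_x \int[pos_dist p mh x]_y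
    ln (1 + r * S x * expR (- dotp (f x) (f y))).
  apply: eq_Rintegral => x _; apply: eq_Rintegral => y _.
  by rewrite SE mulrA softmaxE// mulr_ge0.
rewrite {}lossE; clearbody r; rewrite -integral_by_class//; last 2 first.
- by move=> c x; exact: mean_bound_ge0.
- by move=> c; exact: bm_mean_bound.
have en x y : expR (dotp (f x) (f y)) <= expR n%:R.
  by rewrite ler_expR (le_trans (ler_norm _)) ?dotp_le.
have eNn x y : expR (- dotp (f x) (f y)) <= expR n%:R.
  by rewrite ler_expR (le_trans (ler_norm _)) ?normrN ?dotp_le.
(* The inner integral is compared as a function of x without proving it measurable, at the price of
   a uniform bound: ln (1 + u) <= u, with each exponential at most exp n. *)
apply: (@le_Rintegral_bounded _ _ _ _ _ _
  (r * (\sum_(d : C) expR n%:R) * expR n%:R)) => x.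
- exact: mean_bound_ge0.
(* For fixed x, softplus Jensen replaces the positive sample by its class mean; exp Jensen then does
   the same for each negative class in [S x]. *)
- have := @Jensen_softplus _ _ _ (pos_dist p mh x) _ (r * S x)
    (mulr_ge0 r0 (S0 x)) (bm_dotp mf f_sphere (f x)).
  apply: le_trans; rewrite Rintegral_dotp// -/(class_mean _).
  have sum0 : 0 <= r * \sum_(d | d != h x) mean_gap (h x) d x.
    by rewrite mulr_ge0// sumr_ge0// => d _; exact: mean_gap_ge0.
  rewrite /mean_bound ler_ln ?posrE ?ltr_pwDl// ?mulr_ge0 ?expR_ge0//.
  rewrite lerD2l -mulrA ler_wpM2l// mulr_suml; apply: ler_sum => d _.
  rewrite /mean_gap expRD ler_wpM2r ?expR_ge0//.
  by rewrite -Rintegral_dotp// Jensen_expR//; exact: bm_dotp.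
- rewrite -[leRHS](@prob_Rintegral_cst _ _ _ (pos_dist p mh x)).
  apply: bm_le_Rintegral => [||y].
  + by apply: bm_softplus; [rewrite mulr_ge0 | exact: bm_dotp].
  + exact: bm_cst.
  apply: (@le_trans _ _ (r * S x * expR (- dotp (f x) (f y)))).
    by rewrite le_ln1Dx// (lt_le_trans (ltrN10 _))// !mulr_ge0 ?expR_ge0.
  rewrite ler_pM ?mulr_ge0 ?expR_ge0// ler_wpM2l//.
  rewrite [leRHS](bigD1 (h x))//= (le_trans _ (_ : S x <= _))//.
  rewrite (le_trans (_ : S x <= \sum_(d | d != h x) expR n%:R))//; last first.
    by rewrite lerDr expR_ge0.
  apply: ler_sum => d _.
  rewrite -[leRHS](@prob_Rintegral_cst _ _ _ (class_dist p mh d)).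
  by apply: bm_le_Rintegral => //; exact: bm_cst.
Qed.

End Losses.

Theorem lemma4 (R : realType) (disp : measure_display) (X : measurableType disp)
    (p : probability X R) (C : finType) (h : X -> C)
    (mh : forall c : C, measurable (h @^-1` [set c]))
    (tau : R) (n N K : nat) (f : X -> 'cV[R]_n)
    (card_C : (2 <= #|C|)%N)
    (unif_h : forall c : C, p (h @^-1` [set c]) = tau%:E)
    (K_gt0 : (0 < K)%N) (K_le : (K <= #|C|)%N)
    (mf : measurable_embedding f)
    (f_sphere : forall x : X, l2norm (f x) = 1)
    (N_ge : (K - 1 <= N)%N) :
  sup_loss p mh K f <= mean_sup_loss p mh K f
  /\ mean_sup_loss p mh K f <= debiased_loss p mh N tau f.
Proof.
split; first exact: sup_loss_le_mean.
apply: le_trans (debiased_loss_ge mh unif_h mf f_sphere N card_C).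
have C0 : #|C|%:R != 0 :> R by rewrite pnatr_eq0 -lt0n (ltn_trans _ card_C).
have C1 : 0 < (#|C|%:R - 1 : R) by rewrite subr_gt0 ltr1n.
(* Since [tau] is the inverse of [#|C|], multiplying this weight by [#|C| - 1] gives [N], so the
   condition of [mean_sup_loss_le] becomes K - 1 <= N. *)
have rE : N%:R / (1 - tau) * tau = N%:R / (#|C|%:R - 1).
  rewrite (tauE mh unif_h); field.
  by rewrite C0 gt_eqF.
apply: mean_sup_loss_le => //; rewrite ?K_gt0// rE.
  by rewrite divr_ge0// ltW.
have -> : (#|C|.-1)%:R = #|C|%:R - 1 :> R by rewrite -subn1 natrB// ltnW.
by rewrite divfK ?gt_eqF// ler_nat -subn1.
Qed.
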